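(* Let $G$ be a decompleted capped X-ladder with $|V(G)|\ge 7$. That is, for an integer $m\ge 4$, let $\Gamma$ be the 4-regular graph with vertices $u_1,v_1,\dots,u_m,v_m$ whose edges are $u_iu_{i+1},\,u_iv_{i+1},\,v_iu_{i+1},\,v_iv_{i+1}$ for $1\le i\le m-1$, together with the four edges $u_1v_1,\ u_mv_m,\ u_1u_m,\ v_1v_m$, and let $G=\Gamma\setminus u_1$. Then $c_2^{(2)}(G)=0$.
   Context: $\Gamma\setminus u_1$ denotes the graph obtained by deleting the vertex $u_1$ and its incident edges. For a connected graph $G$, assign a variable $\alpha_e$ to each edge $e$. The Kirchhoff polynomial is $\Psi_G=\sum_T\prod_{e\notin T}\alpha_e$, the sum running over all spanning trees $T$ of $G$. For a prime $p$, $[\Psi_G]_p$ is the number of zeros of $\Psi_G$ in $\mathbb{F}_p^{|E(G)|}$. If $G$ has at least 3 vertices, then $[\Psi_G]_p$ is divisible by $p^2$, and the $c_2$ invariant of $G$ at $p$ is $c_2^{(p)}(G)=\frac{[\Psi_G]_p}{p^2}\bmod p$. *)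

(* Defs.v *)
From HB Require Import structures.
From mathcomp Require Import all_boot all_order all_algebra.
From mathcomp Require Import mpoly.

Set Implicit Arguments.
Unset Strict Implicit.
Unset Printing Implicit Defensive.

Import GRing.Theory.

Record sgraph := SGraph {
  vertex :> finType;
  adj : rel vertex;
  adj_sym : ssrbool.symmetric adj;
  adj_irr : irreflexive adj
}.

Definition edges (G : sgraph) : {set {set G}} :=
  [set [set e.1; e.2] | e in [set e : G * G | adj e.1 e.2]].

(* The simple graph whose edges are the pairs {x, y}, x != y, with r x y. *)
Section GraphOf.
Variables (V : finType) (r : rel V).

Definition graph_of_rel : rel V := [rel x y | (x != y) && (r x y || r y x)].

Lemma graph_of_rel_sym : ssrbool.symmetric graph_of_rel.
Proof. by move=> x y; rewrite /graph_of_rel /= eq_sym orbC. Qed.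

Lemma graph_of_rel_irr : irreflexive graph_of_rel.
Proof. by move=> x; rewrite /graph_of_rel /= eqxx. Qed.

Definition graph_of : sgraph := SGraph graph_of_rel_sym graph_of_rel_irr.
End GraphOf.

Section DelVertex.
Variables (G : sgraph) (v : G).

Definition del_vertex_rel : rel {x : G | x != v} :=
  [rel x y | adj (val x) (val y)].

Lemma del_vertex_sym : ssrbool.symmetric del_vertex_rel.
Proof. by move=> x y; exact: adj_sym. Qed.

Lemma del_vertex_irr : irreflexive del_vertex_rel.
Proof. by move=> x; exact: adj_irr. Qed.

Definition del_vertex : sgraph := SGraph del_vertex_sym del_vertex_irr.
End DelVertex.

Section SpanningTrees.
Variable V : finType.
Implicit Type T : {set {set V}}.

Definition edge_rel T : rel V := [rel x y | [set x; y] \in T].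

Definition spans T : bool := [forall x, forall y, connect (edge_rel T) x y].

(* A cycle is a closed walk through at least three vertices, all distinct;
   it has at most #|V| of them, which makes the quantification finite. *)
Definition acyclic T : bool :=
  [forall k : 'I_#|V|.+1, forall c : k.-tuple V,
     ~~ [&& 2 < k, uniq c & cycle (edge_rel T) c]].
End SpanningTrees.

Definition spanning_tree (G : sgraph) (T : {set {set G}}) : bool :=
  [&& T \subset edges G, spans T & acyclic T].

(* The variable 'X_i stands for alpha_e, where e = enum_val i is the i-th
   edge of G. *)
Definition kirchhoff (G : sgraph) : {mpoly int[#|edges G|]} :=
  (\sum_(T : {set {set G}} | spanning_tree T)
     \prod_(i < #|edges G| | enum_val i \notin T) 'X_i)%R.

(* [P]_p; only meaningful for p prime, as 'F_p is the field with p elements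
   only in that case. *)
Definition point_count (p n : nat) (P : {mpoly int[n]}) : nat :=
  #|[set a : {ffun 'I_n -> 'F_p} | (map_mpoly intr P).@[a] == 0%R]|.

(* The quotient is exact when p is prime and G is connected with at least
   three vertices. *)
Definition c2 (p : nat) (G : sgraph) : nat :=
  (point_count p (kirchhoff G) %/ p ^ 2) %% p.

(* (i, false) is the vertex u_(i+1) and (i, true) is the vertex v_(i+1). *)
Definition ladder_edge (m : nat) : rel ('I_m * bool) :=
  [rel x y : 'I_m * bool |
    [|| y.1 == x.1.+1 :> nat,
        [&& x.1 == 0 :> nat, y.1 == 0 :> nat & x.2 != y.2],
        [&& x.1 == m.-1 :> nat, y.1 == m.-1 :> nat & x.2 != y.2]
      | [&& x.1 == 0 :> nat, y.1 == m.-1 :> nat & x.2 == y.2]]].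

Definition capped_X_ladder (m : nat) : sgraph := graph_of (@ladder_edge m).

Definition u1 (m : nat) (m_gt0 : 0 < m) : capped_X_ladder m :=
  (Ordinal m_gt0, false).

Definition decompleted_capped_X_ladder (m : nat) (m_gt0 : 0 < m) : sgraph :=
  del_vertex (u1 m_gt0).

(* Main.v *)
Require Import Defs.
From mathcomp Require Import all_boot all_order all_algebra.
From mathcomp Require Import perm mpoly.

(* Over F_2 a point of F_2^E is the set F of edges where it vanishes, and
   Psi_G takes at F the value of t(F), the number of spanning trees
   containing F, modulo 2.  So the claim follows once 8 divides the number of
   F with t(F) even.  The graph has a vertex r = v_1 of degree 3, with
   neighbours x = u_2, y = v_2 and z = v_m.  Fix the part F0 of F off the star
   of r, and let t_S be the number of trees that contain F0 and meet the star
   exactly in S.  Modulo 2, t_S vanishes for S empty, it takes the same value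
   at the three singletons, and its values at the three pairs sum to 0;
   hence, whatever F0 is, the number of good F above F0 is a multiple of 4.
   The twins u = u_3 and v = v_3 can be exchanged by an automorphism fixing
   the star.  A spanning tree invariant under it must contain the whole star,
   since x and y have no neighbours besides r, u and v.  So for an invariant F0
   all t_S are even except possibly for S the full star, and the number of good
   F above F0 is 0 or 8, whereas the other F0 come in pairs with equal
   numbers. *)

Set Implicit Arguments.
Unset Strict Implicit.
Unset Printing Implicit Defensive.

Import GRing.Theory.

(** * Parity of sums under an involution, and sums over subsets *)

(** Points moved by [s] pair up with equal summands and cancel modulo 2, which leaves the fixed
    points, whose summands are even. *)
Lemma odd_sum_involution (T : finType) (P : pred T) (s : T -> T) (f : T -> nat) :
    involutive s -> (forall x, P (s x) = P x) -> (forall x, P x -> f (s x) = f x) ->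
    (forall x, P x -> s x = x -> ~~ odd (f x)) ->
  ~~ odd (\sum_(x | P x) f x).
Proof.
move=> sK Ps fs fix_even.
(* The order given by [enum_rank] picks one representative from each two-point orbit. *)
have rank_eq x y : (enum_rank x == enum_rank y :> nat) = (x == y).
  by rewrite -[RHS](inj_eq enum_rank_inj).
rewrite (bigID (fun x => enum_rank x < enum_rank (s x))) /=.
rewrite [X in _ + X](bigID (fun x => enum_rank (s x) < enum_rank x)) /=.
have -> : \sum_(x | P x && ~~ (enum_rank x < enum_rank (s x)) &&
             (enum_rank (s x) < enum_rank x)) f x =
          \sum_(x | P x && (enum_rank x < enum_rank (s x))) f x.
  rewrite (reindex_inj (inv_inj sK)); apply: eq_big => [x|x]; last first.
    by rewrite Ps => /andP[/andP[/fs]].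
  rewrite sK Ps -andbA -leqNgt; case: (P x) => //=.
  by rewrite andb_idl // => /ltnW.
rewrite addnA addnn oddD odd_double /= big_mkcond.
elim/big_ind: _ => [|a b|x _] //; first by rewrite oddD => /negPf-> /negPf->.
case: ifP => // /andP[/andP[Px]]; rewrite -!leqNgt => le1 le2.
by apply: fix_even => //; apply/eqP; rewrite -rank_eq eqn_leq le1 le2.
Qed.

Lemma sum_subsets_setD1 (X : finType) (E : {set X}) (e : X) (f : {set X} -> nat) :
    e \in E ->
  \sum_(F : {set X} | F \subset E) f F =
  \sum_(F : {set X} | F \subset E :\ e) (f F + f (e |: F)).
Proof.
move=> eE; rewrite (bigID (fun F : {set X} => e \in F)) /= addnC big_split /=.
congr (_ + _); first by apply: eq_bigl => F; rewrite subsetD1.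
rewrite (reindex_onto (fun F => e |: F) (fun F => F :\ e)) /=; last first.
  by move=> F /andP[_ eF]; rewrite setD1K.
apply: eq_bigl => F; rewrite subUset sub1set eE setU11 andbT /= subsetD1.
congr (_ && _); apply/eqP/idP => [<-|/setU1K //]; by rewrite setD11.
Qed.

(** * Counting modulo 8 above a three-edge star, for an abstract predicate [tree] *)

Section StarCount.
Variables (X : finType) (E : {set X}) (e1 e2 e3 : X) (tree : pred {set X}).
Variable s : X -> X.
Let E0 : {set X} := E :\ e1 :\ e2 :\ e3.
(* A triple of booleans stands for a subset S of the star {e1, e2, e3}. *)
Let ins (b : bool) e (T : {set X}) := if b then e |: T else T.
Let ins3 (b : bool * bool * bool) (T : {set X}) :=
  ins b.1.1 e1 (ins b.1.2 e2 (ins b.2 e3 T)).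

(** The order is the one in which splitting off [e1], [e2] and [e3] in turn produces the summands,
    so that [sum_ins3] closes by associativity. *)
Let bools3 := [:: (false, false, false); (true, false, false);
  (false, true, false); (true, true, false); (false, false, true);
  (true, false, true); (false, true, true); (true, true, true)].
Let le3 (b c : bool * bool * bool) :=
  [&& b.1.1 ==> c.1.1, b.1.2 ==> c.1.2 & b.2 ==> c.2].

Hypotheses (e1E : e1 \in E) (e2E : e2 \in E) (e3E : e3 \in E).
Hypothesis e_uniq : uniq [:: e1; e2; e3].

Let e12 : e1 != e2. Proof. by move: e_uniq; rewrite /= !inE; case: eqP. Qed.
Let e13 : e1 != e3.
Proof. by move: e_uniq; rewrite /= !inE negb_or -andbA => /and3P[]. Qed.
Let e23 : e2 != e3.
Proof. by move: e_uniq; rewrite /= !inE negb_or -andbA => /and4P[]. Qed.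

Let sum_ins3 (f : {set X} -> nat) :
  \sum_(F : {set X} | F \subset E) f F =
  \sum_(F : {set X} | F \subset E0) \sum_(b <- bools3) f (ins3 b F).
Proof.
rewrite (sum_subsets_setD1 _ e1E) (@sum_subsets_setD1 _ _ e2); last first.
  by rewrite !inE eq_sym e12.
rewrite (@sum_subsets_setD1 _ _ e3); last first.
  by rewrite !inE eq_sym e23 eq_sym e13.
by apply: eq_bigr => F _; rewrite !big_cons big_nil /ins3 /= addn0 !addnA.
Qed.

Let notin_ins b e e' (T : {set X}) : e != e' -> e \notin T -> e \notin ins b e' T.
Proof. by case: b => //= /negPf ee' /negPf eT; rewrite !inE ee' eT. Qed.

Let ins_subset b c e (F T : {set X}) : e \notin F -> e \notin T ->
  (ins b e F \subset ins c e T) = (b ==> c) && (F \subset T).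
Proof.
move=> eF eT; case: b; case: c => //=; rewrite ?subUset ?sub1set ?setU11 ?(negPf eT) //=.
  by rewrite -subDset (setDidPl _) // disjoint_sym disjoints1.
by rewrite -subDset (setDidPl _) // disjoint_sym disjoints1.
Qed.

Let E0P (F : {set X}) :
  F \subset E0 -> [/\ e1 \notin F, e2 \notin F & e3 \notin F].
Proof. by rewrite !subsetD1 -!andbA => /and4P[]. Qed.

Let ins3_subset b c (F T : {set X}) : F \subset E0 -> T \subset E0 ->
  (ins3 b F \subset ins3 c T) = le3 b c && (F \subset T).
Proof.
move=> /E0P[F1 F2 F3] /E0P[T1 T2 T3].
by rewrite /ins3 !ins_subset ?notin_ins // /le3 !andbA.
Qed.

(** [count_trees] is the function t; for [F] off the star, [count_trees0 b F] is t_S with S encoded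
    by [b]. *)
Let count_trees (F : {set X}) : nat :=
  \sum_(T : {set X} | T \subset E) ((F \subset T) && tree T).
Let count_trees0 b (F : {set X}) : nat :=
  \sum_(T : {set X} | T \subset E0) ((F \subset T) && tree (ins3 b T)).

(** A tree containing [F] and the part [c] of the star meets the star in some S that includes [c],
    and is counted by exactly that t_S. *)
Let count_trees_ins3 c (F : {set X}) : F \subset E0 ->
  count_trees (ins3 c F) = \sum_(b <- bools3) le3 c b * count_trees0 b F.
Proof.
move=> FE0; rewrite /count_trees sum_ins3 exchange_big /=.
apply: eq_bigr => b _; rewrite big_distrr /=; apply: eq_bigr => T TE0.
by rewrite ins3_subset // -andbA -mulnb.
Qed.

Hypothesis tree_meets : forall T, tree T -> [|| e1 \in T, e2 \in T | e3 \in T].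
Hypothesis tree_leaf : forall T : {set X}, T \subset E0 ->
  tree (e1 |: T) = tree (e2 |: T) /\ tree (e2 |: T) = tree (e3 |: T).
Hypothesis tree_fork : forall T : {set X}, T \subset E0 ->
  tree (e1 |: (e2 |: T)) (+) tree (e1 |: (e3 |: T)) (+) tree (e2 |: (e3 |: T)) = false.
Hypothesis sK : involutive s.
Hypothesis sE : forall e, (s e \in E) = (e \in E).
Hypotheses (s1 : s e1 = e1) (s2 : s e2 = e2) (s3 : s e3 = e3).
Hypothesis s_tree : forall T : {set X}, tree (s @: T) = tree T.
Hypothesis tree_fixed :
  forall T, tree T -> s @: T = T -> [&& e1 \in T, e2 \in T & e3 \in T].

Let simgK : involutive (fun T : {set X} => s @: T).
Proof.
by move=> T; rewrite -imset_comp -[RHS]imset_id; apply: eq_imset => e /=; exact: sK.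
Qed.

Let mem_simg e (T : {set X}) : (e \in s @: T) = (s e \in T).
Proof. by rewrite -{1}(sK e) (mem_imset _ _ (inv_inj sK)). Qed.

Let simg_subset (F T : {set X}) : (s @: F \subset s @: T) = (F \subset T).
Proof.
by apply/idP/idP => [/(imsetS s)|]; [rewrite !simgK|exact: imsetS].
Qed.

Let simg_ins3 b (T : {set X}) : s @: ins3 b T = ins3 b (s @: T).
Proof.
by case: b => [[[] []] []]; rewrite /ins3 /= ?imsetU1 ?s1 ?s2 ?s3.
Qed.

Let simg_E0 : s @: E0 = E0.
Proof.
apply/setP => e; rewrite mem_simg !inE sE.
by rewrite -{1}s1 -{1}s2 -{1}s3 !(inj_eq (inv_inj sK)).
Qed.

Let simg_subE0 (T : {set X}) : (s @: T \subset E0) = (T \subset E0).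
Proof. by rewrite -{1}simg_E0 simg_subset. Qed.

Let count_trees0_simg b (F : {set X}) : count_trees0 b (s @: F) = count_trees0 b F.
Proof.
rewrite /count_trees0 (reindex_inj (inv_inj simgK)) /=.
apply: eq_big => [T|T _]; first exact: simg_subE0.
by rewrite simg_subset -simg_ins3 s_tree.
Qed.

(** The involution acts on the trees counted by t_S, and a tree that it fixes contains the whole
    star, so it is counted only for S full. *)
Let count_trees0_fixed b (F : {set X}) :
  F \subset E0 -> s @: F = F -> b != (true, true, true) ->
  ~~ odd (count_trees0 b F).
Proof.
move=> FE0 sF b_neq; apply: (odd_sum_involution simgK) => [T|T|T TE0 sT].
- exact: simg_subE0.
- by move=> _; rewrite -{1}sF simg_subset -simg_ins3 s_tree.
have [e1T e2T e3T] := E0P TE0.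
case: (boolP (tree _)) => [tT|]; last by rewrite andbF.
have := tree_fixed tT; rewrite simg_ins3 sT => /(_ erefl).
case: b b_neq {tT} => [[[] []] []] //=; rewrite /ins3 /= ?inE;
  by rewrite ?(negPf e1T) ?(negPf e2T) ?(negPf e3T) ?[e3 == _]eq_sym ?[e2 == e1]eq_sym
    ?(negPf e12) ?(negPf e13) ?(negPf e23) ?andbF.
Qed.

Let odd_count_trees0 (F : {set X}) : F \subset E0 ->
  exists A B D g, forall b, odd (count_trees0 b F) =
   match b with
   | (false, false, false) => false
   | (true, false, false) | (false, true, false) | (false, false, true) => D
   | (true, true, false) => A (+) B
   | (true, false, true) => A
   | (false, true, true) => B
   | (true, true, true) => g
   end.
Proof.
move=> FE0.
exists (odd (count_trees0 (true, false, true) F)), (odd (count_trees0 (false, true, true) F)),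
  (odd (count_trees0 (true, false, false) F)), (odd (count_trees0 (true, true, true) F)).
have eq1 : count_trees0 (true, false, false) F = count_trees0 (false, true, false) F.
  by apply: eq_bigr => T TE0; rewrite /ins3 /= (tree_leaf TE0).1.
have eq2 : count_trees0 (false, true, false) F = count_trees0 (false, false, true) F.
  by apply: eq_bigr => T TE0; rewrite /ins3 /= (tree_leaf TE0).2.
have eq0 : count_trees0 (false, false, false) F = 0.
  apply: big1 => T /E0P[/negPf e1T /negPf e2T /negPf e3T].
  have /contraNF := @tree_meets T.
  by rewrite /ins3 /= e1T e2T e3T => ->; rewrite ?andbF.
have fork : odd (count_trees0 (true, true, false) F) =
    odd (count_trees0 (true, false, true) F) (+) odd (count_trees0 (false, true, true) F).
  apply/eqP; rewrite -negb_add -!oddD -!big_split /=.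
  elim/big_rec: _ => // T n TE0 n_even; rewrite oddD (negPf n_even) addbF.
  have := tree_fork TE0; rewrite /ins3 /=.
  by case: (F \subset T); do 3!case: (tree _).
by case=> [[[] []] []]; rewrite -?eq2 -?eq1 ?eq0.
Qed.

(** The number of zeros of the polynomial, in terms of edge sets, whose part off the star is [F]. *)
Let nz (F : {set X}) : nat :=
  \sum_(c <- bools3) ~~ odd (count_trees (ins3 c F)).

Let odd_count_ins3 c (F : {set X}) : F \subset E0 ->
  odd (count_trees (ins3 c F)) =
  odd (\sum_(b <- bools3) le3 c b * odd (count_trees0 b F)).
Proof.
move=> FE0; rewrite count_trees_ins3 //.
apply: (big_ind2 (fun p q => odd p = odd q)) => // [p p' q q' pp' qq'|b _].
  by rewrite !oddD pp' qq'.
by rewrite !oddM !oddb.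
Qed.

(** Summed over supersets, the eight parities are g + L and D + g + L with L running over 0, A, B, A
    + B. If A = B = 0, each group of four is constant; otherwise each group has two even members. *)
Let dvdn4_nz (F : {set X}) : F \subset E0 -> 4 %| nz F.
Proof.
move=> FE0; have [A [B [D [g Ht]]]] := odd_count_trees0 FE0.
rewrite /nz; under eq_bigr => c _.
  rewrite odd_count_ins3 //; under eq_bigr => b _ do rewrite Ht.
  over.
by rewrite !big_cons !big_nil /=; case: A B D g {Ht} => [] [] [] [].
Qed.

(** Here A = B = D = 0, so all eight parities equal g. *)
Let dvdn8_nz_fixed (F : {set X}) : F \subset E0 -> s @: F = F -> 8 %| nz F.
Proof.
move=> FE0 sF; have [A [B [D [g Ht]]]] := odd_count_trees0 FE0.
have even b (b_neq : b != (true, true, true)) : odd (count_trees0 b F) = false.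
  exact: negPf (count_trees0_fixed FE0 sF b_neq).
have D0 : D = false by have := Ht (true, false, false); rewrite even.
have A0 : A = false by have := Ht (true, false, true); rewrite even.
have B0 : B = false by have := Ht (false, true, true); rewrite even.
subst A B D; rewrite /nz; under eq_bigr => c _.
  rewrite odd_count_ins3 //; under eq_bigr => b _ do rewrite Ht.
  over.
by rewrite !big_cons !big_nil /=; case: g {Ht}.
Qed.

Let nz_simg (F : {set X}) : F \subset E0 -> nz (s @: F) = nz F.
Proof.
move=> FE0; apply: eq_bigr => c _; rewrite !odd_count_ins3 ?simg_subE0 //.
by under eq_bigr => b _ do rewrite count_trees0_simg.
Qed.

Lemma dvdn8_count_even_trees :
  8 %| #|[set F : {set X} | (F \subset E) &&
         ~~ odd #|[set T : {set X} | [&& T \subset E, F \subset T & tree T]]| ]|.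
Proof.
rewrite -sum1dep_card (eq_bigl (fun F : {set X} => (F \subset E) && ~~ odd (count_trees F)));
    last first.
  by move=> F; rewrite -sum1dep_card /count_trees -big_mkcondr.
rewrite big_mkcondr /= (eq_bigr (fun F => ~~ odd (count_trees F) : nat)); last first.
  by move=> F _; case: odd.
(* A factor 4 comes out of every summand; what remains is the parity of the sum of the quotients, to
   which the involution applies. *)
rewrite sum_ins3 (eq_bigr (fun F => nz F %/ 4 * 4)); last first.
  by move=> F FE0; rewrite divnK // dvdn4_nz.
rewrite -big_distrl /= -[8]/(2 * 4) dvdn_pmul2r // dvdn2.
apply: (odd_sum_involution simgK) => [F|F FE0|F FE0 sF]; first exact: simg_subE0.
  by rewrite nz_simg.
by rewrite -dvdn2 dvdn_divRL ?dvdn4_nz // dvdn8_nz_fixed.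
Qed.
End StarCount.

(** * Connectivity and cycles in edge sets *)

Section Graph.
Variable V : finType.
Implicit Types (T : {set {set V}}) (x y a b : V).

Lemma edge_rel_sym T : ssrbool.symmetric (edge_rel T).
Proof. by move=> x y; rewrite /edge_rel /= setUC. Qed.

Lemma connect_edge_sym T : connect_sym (edge_rel T).
Proof. exact/sym_connect_sym/edge_rel_sym. Qed.

Lemma connect_edge_sub T1 T2 x y :
  T1 \subset T2 -> connect (edge_rel T1) x y -> connect (edge_rel T2) x y.
Proof.
move=> /subsetP sT; apply: connect_sub => a b ab.
by apply: connect1; exact: sT.
Qed.

Lemma set2_eqP x y a b :
  reflect (x = a /\ y = b \/ x = b /\ y = a) ([set x; y] == [set a; b]).
Proof.
apply: (iffP idP) => [/eqP/setP eq_xy|[[-> ->]|[-> ->]]] //; last first.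
  by rewrite setUC.
have := eq_xy x; rewrite !inE eqxx => /esym/orP[]/eqP x_eq.
  have := eq_xy y; rewrite !inE eqxx orbT => /esym/orP[]/eqP y_eq; last by left.
  by have := eq_xy b; rewrite !inE x_eq y_eq eqxx orbb orbT => /eqP; left.
have := eq_xy y; rewrite !inE eqxx orbT => /esym/orP[]/eqP y_eq; first by right.
by have := eq_xy a; rewrite !inE x_eq y_eq eqxx orbb => /eqP; left.
Qed.

(** A walk needs the new edge at most once, in one of its two directions. *)
Lemma connect_edgeU1 T x y a b :
  connect (edge_rel ([set x; y] |: T)) a b =
  [|| connect (edge_rel T) a b,
      connect (edge_rel T) a x && connect (edge_rel T) y b
    | connect (edge_rel T) a y && connect (edge_rel T) x b].
Proof.
have sT : T \subset [set x; y] |: T by rewrite subsetUr.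
have cxy : connect (edge_rel ([set x; y] |: T)) x y.
  by apply: connect1; rewrite /edge_rel /= setU11.
apply/idP/idP => [|/or3P[|/andP[ax yb]|/andP[ay xb]]]; last 3 first.
- exact: connect_edge_sub.
- apply: connect_trans (connect_edge_sub sT ax) _.
  exact: connect_trans cxy (connect_edge_sub sT yb).
- apply: connect_trans (connect_edge_sub sT ay) _.
  by rewrite connect_edge_sym in cxy; exact: connect_trans cxy (connect_edge_sub sT xb).
case/connectP => p; elim: p a => [|c p IHp] a /= => [_ ->|/andP[]].
  by rewrite connect0.
move=> /setU1P[/eqP/set2_eqP ac|ac] /IHp{}IHp {}/IHp; last first.
  have cac : connect (edge_rel T) a c by exact: connect1.
  by case/or3P=> [|/andP[]|/andP[]] /(connect_trans cac)-> => [|->|->]; rewrite ?orbT.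
case: ac => [[-> ->]|[-> ->]] /or3P[->|/andP[_ ->]|/andP[_ ->]];
  by rewrite ?connect0 ?orbT.
Qed.

Lemma acyclicP T :
  reflect (forall c, uniq c -> 2 < size c -> ~~ cycle (edge_rel T) c) (acyclic T).
Proof.
apply: (iffP forallP) => [acT c uc c2|acT k]; last first.
  apply/forallP => c; apply/and3P => -[k2 uc].
  by apply/negP/acT => //; rewrite size_tuple.
have ck : size c < #|V|.+1 by rewrite ltnS -(card_uniqP uc) max_card.
have /forallP/(_ (in_tuple c)) := acT (Ordinal ck).
by rewrite /= c2 uc.
Qed.

(** A path joining the ends of an edge without using it closes to a cycle, and a cycle minus one
    edge is such a path: acyclic sets are those in which every edge is a bridge. *)
Lemma acyclic_bridgeP T :
  reflect (forall x y, x != y -> [set x; y] \in T ->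
             ~~ connect (edge_rel (T :\ [set x; y])) x y)
          (acyclic T).
Proof.
apply: (iffP (acyclicP T)) => [acT x y xy xyT|brT c uc c2].
  apply/negP => /connectP[p0 /shortenP[p px up _] yE].
  (* A shorter path would give x = y or consist of the removed edge; so the closed path has at least
     three vertices. *)
  have sp : 1 < size p.
    case: p px yE {up} => [|a [|b p]] //= => [_ yx|]; first by rewrite yx eqxx in xy.
    by rewrite andbT => + yE; rewrite /edge_rel /= yE setD11.
  have /negP[] := acT (x :: p) up sp.
  rewrite /= rcons_path -yE [edge_rel _ y x]/edge_rel /= setUC xyT andbT.
  by apply: sub_path px => a b /setD1P[].
apply/negP => cyc.
case: c uc c2 cyc => [|x p] // uc c2; rewrite /= rcons_path => /andP[px lx].
have xl : x != last x p.
  case/lastP: p uc c2 {px lx} => // p y + _; rewrite last_rcons /= mem_rcons inE.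
  by case/andP; rewrite negb_or => /andP[].
(* The edge taken out of the cycle is the one from its last vertex back to x. *)
have /negP[] := brT x (last x p) xl (etrans (congr1 _ (setUC _ _)) lx).
apply/connectP; exists p => //.
case: p uc c2 px {lx} xl => // y [//|z p] /= uc _ /andP[xy px] xl.
rewrite {1}/edge_rel /= in_setD1 [_ \in T]xy andbT.
have ylast : y != last z p.
  by apply: contraTneq uc => ->; rewrite mem_last /= andbF.
apply/andP; split.
  by apply/negP => /set2_eqP[[_ /eqP yl]|[/eqP xl' _]]; [rewrite yl in ylast|rewrite xl' in xl].
have xp : x \notin y :: z :: p by case/andP: uc.
have sub_rel : {in predC1 x &, subrel (edge_rel T) (edge_rel (T :\ [set x; last z p]))}.
  move=> a b ax bx ab; rewrite /edge_rel /= in_setD1 [_ \in T]ab andbT.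
  apply/negP => /set2_eqP[[ax' _]|[_ bx']]; first by rewrite ax' inE eqxx in ax.
  by rewrite bx' inE eqxx in bx.
by apply: (sub_in_path sub_rel (x := y) (s := z :: p)) px;
  apply/allP => z' z'p; apply: contraNneq xp => <-.
Qed.

Lemma acyclicU1 T x y : x != y -> [set x; y] \notin T ->
  acyclic ([set x; y] |: T) = acyclic T && ~~ connect (edge_rel T) x y.
Proof.
move=> xy xyT; apply/idP/andP => [/acyclic_bridgeP acT|[/acyclic_bridgeP acT nxy]].
  split; last by have := acT x y xy (setU11 _ _); rewrite setU1K.
  apply/acyclic_bridgeP => a b ab abT.
  apply: contra (acT a b ab (setU1r _ abT)).
  by apply: connect_edge_sub; exact/setSD/subsetUr.
apply/acyclic_bridgeP => a b ab; case: (altP ([set a; b] =P [set x; y])) => [eq_ab _|ab_xy].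
  rewrite eq_ab setU1K //; apply: contra nxy.
  have /eqP/set2_eqP[[-> ->]|[-> ->]] // := eq_ab.
  by rewrite connect_edge_sym.
case/setU1P => [/eqP|abT]; first by rewrite (negPf ab_xy).
(* Since ab is a bridge of T, a path from a to b avoiding it must use xy; together with ab, its
   remaining parts connect x to y in T. *)
have -> : ([set x; y] |: T) :\ [set a; b] = [set x; y] |: T :\ [set a; b].
  apply/setP => e; rewrite !inE; case: (eqVneq e [set x; y]) => [->|_] //=.
  by rewrite eq_sym ab_xy.
have sub p q : connect (edge_rel (T :\ [set a; b])) p q -> connect (edge_rel T) p q.
  by apply: connect_edge_sub; exact: subsetDl.
have cab : connect (edge_rel T) a b by exact: connect1.
have cba : connect (edge_rel T) b a by rewrite connect_edge_sym.
rewrite connect_edgeU1 (negPf (acT a b ab abT)) /=; apply: contra nxy.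
case/orP=> /andP[/sub c1 /sub c2].
  rewrite connect_edge_sym in c1; rewrite connect_edge_sym in c2.
  exact: connect_trans (connect_trans c1 cab) c2.
exact: connect_trans (connect_trans c2 cba) c1.
Qed.

Definition tree T := spans T && acyclic T.

(** * Trees obtained by attaching a vertex r to a forest *)

Section Star.
Variables (T : {set {set V}}) (r : V).
Hypothesis r_free : forall e, e \in T -> r \notin e.

Let r_notin x : [set r; x] \notin T.
Proof. by apply/negP => /r_free; rewrite set21. Qed.

Let connect_r a : connect (edge_rel T) r a = (r == a).
Proof.
apply/idP/eqP => [/connectP[[|b p]] //=|<-]; last exact: connect0.
by rewrite {1}/edge_rel /= (negPf (r_notin b)).
Qed.

Let connect_to_r a : connect (edge_rel T) a r = (r == a).
Proof. by rewrite connect_edge_sym connect_r. Qed.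

(** The vertex r is a leaf, so T must be a tree on the other vertices. The right-hand side does not
    mention x, which makes single star edges interchangeable. *)
Lemma tree_leafE x : r != x ->
  tree ([set r; x] |: T) =
  acyclic T && [forall a, forall b, (a != r) && (b != r) ==> connect (edge_rel T) a b].
Proof.
move=> rx; rewrite /tree acyclicU1 // connect_r (negPf rx) andbT andbC; congr (_ && _).
apply/forallP/forallP => span a; apply/forallP => b.
  apply/implyP => /andP[ar br]; have /forallP/(_ b) := span a.
  rewrite eq_sym in ar; rewrite eq_sym in br.
  by rewrite connect_edgeU1 connect_r connect_to_r (negPf ar) (negPf br) andbF /= !orbF.
have {}span c d : c != r -> d != r -> connect (edge_rel T) c d.
  by move=> cr dr; have /forallP/(_ d)/implyP := span c; rewrite cr dr; apply.
rewrite connect_edgeU1 connect_r connect_to_r.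
have [<-|ar] := eqVneq r a; have [<-|br] := eqVneq r b; rewrite ?connect0 //=.
- by rewrite (span x b) /= ?orbT // eq_sym.
- by rewrite (span a x) /= ?orbT // eq_sym.
- by rewrite span // eq_sym.
Qed.

(** Attaching r by two edges merges two components, so off r the forest T must have exactly two, one
    containing x and the other y. *)
Lemma tree_forkE x y : r != x -> r != y -> x != y ->
  tree ([set r; x] |: ([set r; y] |: T)) =
  [&& acyclic T, ~~ connect (edge_rel T) x y &
    [forall a, (a != r) ==> connect (edge_rel T) a x || connect (edge_rel T) a y]].
Proof.
move=> rx ry xy; rewrite /tree !acyclicU1 //; last first.
  rewrite in_setU1 negb_or r_notin andbT; apply/set2_eqP => -[[_ /eqP]|[/eqP]].
    by rewrite (negPf xy).
  by rewrite (negPf ry).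
rewrite connect_edgeU1 !connect_r eqxx (negPf rx) (negPf ry) /= orbF andbT.
rewrite andbC -andbA [connect _ y x]connect_edge_sym; congr (_ && _).
case: (boolP (connect _ x y)) => //= nxy.
apply/forallP/forallP => span a.
  rewrite eq_sym; apply/implyP => ar; have /forallP/(_ r) := span a.
  rewrite !connect_edgeU1 !connect_r !connect_to_r eqxx (negPf ar) (negPf rx) (negPf ry) /=.
  by rewrite ?andbT ?andbF ?orbF; case: (connect _ a x); case: (connect _ a y).
set T' := _ |: _.
have sT : T \subset T' by apply: subset_trans (subsetUr _ _); exact: subsetUr.
have to_r c : connect (edge_rel T') c r.
  have [->|cr] := eqVneq c r; first exact: connect0.
  have /implyP/(_ cr)/orP[cx|cy] := span c.
    apply: connect_trans (connect_edge_sub sT cx) _.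
    by apply: connect1; rewrite /edge_rel /= setUC setU11.
  apply: connect_trans (connect_edge_sub sT cy) _.
  by apply: connect1; rewrite /edge_rel /= setUC setU1r // setU11.
apply/forallP => c; apply: connect_trans (to_r a) _.
by rewrite connect_edge_sym.
Qed.

(** All terms vanish unless T is a forest with two components off r. These split x, y, z as 3+0 or
    2+1, so none or exactly two of the three pairs are separated. *)
Lemma tree_fork_even x y z : uniq [:: r; x; y; z] ->
  tree ([set r; x] |: ([set r; y] |: T)) (+)
  tree ([set r; x] |: ([set r; z] |: T)) (+)
  tree ([set r; y] |: ([set r; z] |: T)) = false.
Proof.
rewrite /= !inE !negb_or andbT -!andbA => /and5P[rx ry rz xy /andP[xz yz]].
rewrite !tree_forkE //; case: (acyclic T) => //=.
pose P a b := ~~ connect (edge_rel T) a b &&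
  [forall c, (c != r) ==> connect (edge_rel T) c a || connect (edge_rel T) c b].
rewrite -[_ && _]/(P x y) -[X in _ (+) X (+) _]/(P x z) -[X in _ (+) _ (+) X]/(P y z).
have PC a b : P a b = P b a.
  rewrite /P connect_edge_sym; congr (_ && _); apply: eq_forallb => c.
  by rewrite orbC.
have connect_eq a b c : connect (edge_rel T) a b ->
    connect (edge_rel T) c a = connect (edge_rel T) c b.
  by move=> ab; rewrite !(connect_edge_sym T c) (same_connect (connect_edge_sym T) ab).
(* When a and b represent the two components, c lies in exactly one of them and is separated from
   exactly one of a and b. *)
have P_xor a b c : r != c -> P a b -> P a c (+) P b c.
  move=> rc /andP[nab span]; rewrite eq_sym in rc.
  have /orP[ca|cb] := implyP (forallP span c) rc.
    rewrite {1}/P connect_edge_sym ca /= /P (connect_eq _ _ b ca) connect_edge_sym nab.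
    by apply/forallP => d; rewrite (connect_eq _ _ d ca) orbC; exact: forallP span d.
  rewrite addbC {1}/P [connect _ b c]connect_edge_sym cb /= /P (connect_eq _ _ a cb) nab.
  by apply/forallP => d; rewrite (connect_eq _ _ d cb); exact: forallP span d.
have := P_xor x y z rz; have := P_xor x z y ry; have := P_xor y z x rx.
rewrite (PC y x) (PC z x) (PC z y).
by case: (P x y); case: (P x z); case: (P y z) => // H1 H2 H3;
  first [have := H1 isT | have := H2 isT | have := H3 isT].
Qed.
End Star.

(** Used to force edges into a spanning set: if they were missing, some nonempty proper set of
    vertices would be closed. *)
Lemma spans_closed T (W : pred V) : spans T ->
  (forall a b, [set a; b] \in T -> W a -> W b) -> forall a b, W a -> W b.
Proof.
move=> /forallP spT closedW a b Wa; have /forallP/(_ b) := spT a.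
have clW : closed (edge_rel T) W.
  by apply: (intro_closed (connect_edge_sym T)) => c d cd; exact: closedW.
by move/(closed_connect clW); rewrite !unfold_in Wa => <-.
Qed.

Lemma acyclic_square T a b c d : acyclic T -> uniq [:: a; b; c; d] ->
  [set a; b] \in T -> [set b; c] \in T -> [set c; d] \in T -> [set d; a] \notin T.
Proof.
move=> /acyclicP acT uc ab bc cd; have := acT _ uc isT.
by rewrite /= /edge_rel /= ab bc cd andbT.
Qed.
End Graph.

(** * Spanning trees invariant under exchanging twins *)

Section FixedTree.
Variables (G : sgraph) (r x y z u v : G) (T : {set {set G}}).

Lemma mem_edges (a b : G) : ([set a; b] \in edges G) = adj a b.
Proof.
apply/imsetP/idP => [[[c d]]|ab]; last by exists (a, b); rewrite ?inE.
rewrite inE /= => cd /eqP/set2_eqP[[-> ->] //|[-> ->]]; by rewrite adj_sym.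
Qed.

Hypotheses (treeT : spanning_tree T) (uniqG : uniq [:: r; x; y; z; u; v]).
Hypothesis adj_r : forall w, adj r w -> w \in [:: x; y; z].
Hypothesis adj_x : forall w, adj x w -> w \in [:: r; u; v].
Hypothesis adj_y : forall w, adj y w -> w \in [:: r; u; v].
Hypothesis twin : forall w, adj u w = adj v w.
Hypothesis invT : forall w, w != u -> w != v -> ([set u; w] \in T) = ([set v; w] \in T).

(** If x or y is joined to u in T, [arm] applies, with x and y in either role. Otherwise, by
    invariance, neither is joined to u or v; both then hang on r, and T can leave {r, x, y} only
    through r-z. *)
Lemma fixed_star :
  [&& [set r; x] \in T, [set r; y] \in T & [set r; z] \in T].
Proof.
have [subT spT acT] := and3P treeT.
have adjT a b : [set a; b] \in T -> adj a b.
  by move/(subsetP subT); rewrite mem_edges.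
have setC2 (a b : G) : ([set a; b] \in T) = ([set b; a] \in T) by rewrite setUC.
have closedT (W : seq G) : (forall a b, a \in W -> [set a; b] \in T -> b \in W) ->
    forall a b, a \in W -> b \in W.
  move=> clW a b aW; apply: (spans_closed (W := fun w => w \in W) spT _ b aW).
  by move=> c d cd cW; exact: clW cd.
have Tr w : [set r; w] \in T -> w \in [:: x; y; z] by move/adjT/adj_r.
have Tx w : [set x; w] \in T -> w \in [:: r; u; v] by move/adjT/adj_x.
have Ty w : [set y; w] \in T -> w \in [:: r; u; v] by move/adjT/adj_y.
(* Twins are not adjacent, since an edge u-v would give a loop at v. *)
have Tuv : [set u; v] \notin T by apply: contraFN (adj_irr v) => /adjT; rewrite twin.
have Tirr a : [set a; a] \notin T by apply: contraFN (adj_irr a) => /adjT.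
(* With p-u the tree T also contains p-v, and then u and v have no further
   T-neighbour w, since p, u, w, v would form a cycle.  So q hangs on r alone,
   and T leaves {p, u, v}, then {r, p, q, u, v}, only through r-p and r-z. *)
have arm p q : uniq [:: r; p; q; z; u; v] ->
    (forall w, [set r; w] \in T -> w \in [:: p; q; z]) ->
    (forall w, [set p; w] \in T -> w \in [:: r; u; v]) ->
    (forall w, [set q; w] \in T -> w \in [:: r; u; v]) -> [set p; u] \in T ->
    [&& [set r; p] \in T, [set r; q] \in T & [set r; z] \in T].
  rewrite /= !inE !negb_or -!andbA andbT.
  case/and5P=> rp rq rz ru /and5P[rv pq pz pu /and5P[pv qz qu qv /and3P[zu zv uv]]].
  move=> Tr' Tp Tq Tpu.
  have Tvp : [set v; p] \in T by rewrite -invT // setC2.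
  have Tu w : [set u; w] \in T -> w = p.
    move=> Tuw; apply/eqP; apply: contraT => wp.
    have wu : w != u by apply: contraTneq Tuw => ->.
    have wv : w != v by apply: contraTneq Tuw => ->.
    have Twv : [set w; v] \in T by rewrite setC2 -invT.
    have puwv : uniq [:: p; u; w; v].
      by rewrite /= !inE !negb_or pu pv [p == w]eq_sym wp [u == w]eq_sym wu uv wv.
    by have := acyclic_square acT puwv Tpu Tuw Twv; rewrite Tvp.
  have Tv w : [set v; w] \in T -> w = p.
    move=> Tvw; apply: Tu; rewrite invT //; first by apply: contraTneq Tvw => ->; rewrite setC2.
    by apply: contraTneq Tvw => ->.
  have Tqr w : [set q; w] \in T -> w = r.
    move=> Tqw; have := Tq _ Tqw; rewrite !inE => /or3P[]/eqP // wE.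
      by rewrite -(Tu q) ?eqxx // in pq; rewrite setC2 -wE.
    by rewrite -(Tv q) ?eqxx // in pq; rewrite setC2 -wE.
  have Trq : [set r; q] \in T.
    apply: contraT => nrq.
    have clq a b : a \in [:: q] -> [set a; b] \in T -> b \in [:: q].
      by rewrite !inE => /eqP-> Tqb; have bq := Tqr b Tqb; rewrite bq setC2 (negPf nrq) in Tqb.
    by have := closedT _ clq q r; rewrite !inE eqxx (negPf rq) => /(_ isT).
  have Trp : [set r; p] \in T.
    apply: contraT => nrp.
    have clp a b : a \in [:: p; u; v] -> [set a; b] \in T -> b \in [:: p; u; v].
      rewrite !inE => /or3P[]/eqP->; last 2 first.
      - by move/Tu ->; rewrite eqxx.
      - by move/Tv ->; rewrite eqxx.
      move=> Tpb; have := Tp b Tpb.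
      rewrite !inE => /or3P[/eqP br|->|->]; rewrite ?orbT //.
      by rewrite br setC2 (negPf nrp) in Tpb.
    have := closedT _ clp p r.
    by rewrite !inE eqxx (negPf rp) (negPf ru) (negPf rv) => /(_ isT).
  rewrite Trp Trq /=; apply: contraT => nrz.
  have clr a b : a \in [:: r; p; q; u; v] -> [set a; b] \in T ->
      b \in [:: r; p; q; u; v].
    rewrite !inE => /or4P[|||/orP[]] /eqP->.
    - move=> Trb; have := Tr' b Trb.
      rewrite !inE => /or3P[->|->|/eqP bz]; rewrite ?orbT //.
      by rewrite bz (negPf nrz) in Trb.
    - by move=> /Tp; rewrite !inE => /or3P[]->; rewrite ?orbT.
    - by move=> /Tqr->; rewrite eqxx.
    - by move=> /Tu->; rewrite eqxx orbT.
    - by move=> /Tv->; rewrite eqxx orbT.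
  have := closedT _ clr r z; rewrite !inE eqxx [z == r]eq_sym [z == p]eq_sym.
  by rewrite [z == q]eq_sym (negPf rz) (negPf pz) (negPf qz) (negPf zu) (negPf zv) => /(_ isT).
have uniqG' : uniq [:: r; y; x; z; u; v].
  by rewrite (@perm_uniq _ _ [:: r; x; y; z; u; v]) // perm_cons;
    apply/permEl/(perm_catCA [:: y] [:: x]).
have Tr' w : [set r; w] \in T -> w \in [:: y; x; z].
  by move/Tr; rewrite !inE orbCA.
have [Txu|nxu] := boolP ([set x; u] \in T); first exact: arm.
have [Tyu|nyu] := boolP ([set y; u] \in T); first by rewrite andbCA; exact: arm.
move: uniqG; rewrite /= !inE !negb_or -!andbA andbT.
case/and5P=> rx ry rz ru /and5P[rv xy xz xu /and5P[xv yz yu yv /and3P[zu zv uv]]].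
have leaf p : p != u -> p != v -> [set p; u] \notin T ->
    (forall w, [set p; w] \in T -> w \in [:: r; u; v]) -> r != p ->
    [set r; p] \in T /\ forall w, [set p; w] \in T -> w = r.
  move=> pu pv npu Tp rp.
  have Tpr w : [set p; w] \in T -> w = r.
    move=> Tpw; have := Tp w Tpw; rewrite !inE => /or3P[]/eqP // wE.
      by rewrite -wE Tpw in npu.
    by rewrite setC2 invT // setC2 -wE Tpw in npu.
  split=> //; apply: contraT => nrp.
  have clp a b : a \in [:: p] -> [set a; b] \in T -> b \in [:: p].
    by rewrite !inE => /eqP-> Tpb; have bp := Tpr b Tpb; rewrite bp setC2 (negPf nrp) in Tpb.
  by have := closedT _ clp p r; rewrite !inE eqxx (negPf rp) => /(_ isT).
have [Trx Txr] := leaf x xu xv nxu Tx rx.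
have [Try Tyr] := leaf y yu yv nyu Ty ry.
rewrite Trx Try /=; apply: contraT => nrz.
have clr a b : a \in [:: r; x; y] -> [set a; b] \in T -> b \in [:: r; x; y].
  rewrite !inE => /or3P[]/eqP->.
  - move=> Trb; have := Tr b Trb.
    rewrite !inE => /or3P[->|->|/eqP bz]; rewrite ?orbT //.
    by rewrite bz (negPf nrz) in Trb.
  - by move=> /Txr->; rewrite eqxx.
  - by move=> /Tyr->; rewrite eqxx.
have := closedT _ clr r z; rewrite !inE eqxx [z == r]eq_sym [z == x]eq_sym.
by rewrite [z == y]eq_sym (negPf rz) (negPf xz) (negPf yz) => /(_ isT).
Qed.
End FixedTree.

(** * The automorphism exchanging twins *)

Section Twins.
Variables (G : sgraph) (u v : G).
Hypothesis twin : forall w, adj u w = adj v w.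

Definition swap (w : G) : G := tperm u v w.
Definition swap_edge (e : {set G}) : {set G} := swap @: e.

Lemma swapK : involutive swap.
Proof. exact: tpermK. Qed.

Lemma adj_swap a b : adj (swap a) (swap b) = adj a b.
Proof.
have adj_swapl c d : adj (swap c) d = adj c d.
  by rewrite /swap; case: tpermP => [->|->|].
by rewrite adj_swapl adj_sym adj_swapl adj_sym.
Qed.

Lemma swap_edge_set2 a b : swap_edge [set a; b] = [set swap a; swap b].
Proof. by rewrite /swap_edge imsetU1 imset_set1. Qed.

Lemma swap_edgeK : involutive swap_edge.
Proof.
by move=> e; rewrite /swap_edge -imset_comp -[RHS]imset_id; apply: eq_imset; exact: swapK.
Qed.

Lemma mem_swap_edges e : (swap_edge e \in edges G) = (e \in edges G).
Proof.
suff sub f : f \in edges G -> swap_edge f \in edges G.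
  by apply/idP/idP => [/sub|/sub] //; rewrite swap_edgeK.
case/imsetP => -[a b]; rewrite inE /= => ab ->.
by rewrite swap_edge_set2 mem_edges adj_swap.
Qed.

Implicit Type T : {set {set G}}.

Lemma swap_edgesK T : swap_edge @: (swap_edge @: T) = T.
Proof.
by rewrite -imset_comp -[RHS]imset_id; apply: eq_imset; exact: swap_edgeK.
Qed.

Lemma edge_rel_swap T a b :
  edge_rel (swap_edge @: T) a b = edge_rel T (swap a) (swap b).
Proof.
rewrite /edge_rel /= -swap_edge_set2 -{1}(swap_edgeK [set a; b]).
by rewrite (mem_imset _ _ (inv_inj swap_edgeK)).
Qed.

Lemma spanning_tree_swap T : spanning_tree (swap_edge @: T) = spanning_tree T.
Proof.
suff sub T' : spanning_tree T' -> spanning_tree (swap_edge @: T').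
  by apply/idP/idP => [/sub|/sub] //; rewrite swap_edgesK.
case/and3P => /subsetP sT' /forallP spT' /acyclicP acT'; apply/and3P; split.
- by apply/subsetP => _ /imsetP[e /sT' eE ->]; rewrite mem_swap_edges.
- apply/forallP => a; apply/forallP => b.
  have /forallP/(_ (swap b))/connectP[p pa pb] := spT' (swap a).
  apply/connectP; exists (map swap p); last by rewrite -(swapK a) last_map -pb swapK.
  rewrite -[a]swapK path_map; apply: sub_path pa => c d.
  by rewrite /= edge_rel_swap !swapK.
apply/acyclicP => c uc c2; have := acT' (map swap c).
rewrite (map_inj_uniq (inv_inj swapK)) size_map => /(_ uc c2).
apply: contra; rewrite cycle_map; apply: sub_cycle => a b.
by rewrite /= edge_rel_swap.
Qed.
End Twins.

(** * Zeros over F_2 as edge sets *)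

Section PointCount.
Variable G : sgraph.
Local Notation E := (edges G).

(** At a point of F_2^E the monomial of a tree T is 1 if all vanishing coordinates belong to T, and
    0 otherwise. *)
Lemma point_count2_kirchhoff :
  point_count 2 (kirchhoff G) =
  #|[set F : {set {set G}} | (F \subset E) &&
      ~~ odd #|[set T : {set {set G}} |
                 [&& T \subset E, F \subset T & spanning_tree T]]| ]|.
Proof.
pose zeros (a : {ffun 'I_#|E| -> 'F_2}) : {set {set G}} :=
  [set enum_val i | i in 'I_#|E| & a i == 0%R].
have F2_neq0 (x : 'F_2) : x != 0%R -> x = 1%R.
  by case: x => [[|[|k]] lt_k] //= _; apply: val_inj.
have mem_zeros a i : (enum_val i \in zeros a) = (a i == 0%R).
  rewrite (mem_imset _ _ enum_val_inj) inE //.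
have zeros_inj : injective zeros.
  move=> a b eq_ab; apply/ffunP => i.
  have := mem_zeros a i; rewrite eq_ab mem_zeros.
  have [->|/F2_neq0->] := eqVneq (b i) 0%R; first by move/esym/eqP.
  by have [->|/F2_neq0->] := eqVneq (a i) 0%R.
have zeros_sub a : zeros a \subset E.
  by apply/subsetP => _ /imsetP[i _ ->]; exact: enum_valP.
have evalE (a : {ffun _ -> _}) : (map_mpoly intr (kirchhoff G)).@[a] =
    (#|[set T : {set {set G}} |
         [&& T \subset E, zeros a \subset T & spanning_tree T]]|%:R : 'F_2)%R.
  have -> : map_mpoly (intr : int -> 'F_2) (kirchhoff G) =
      (\sum_(T : {set {set G}} | spanning_tree T)
        \prod_(i < #|E| | enum_val i \notin T) 'X_i)%R.
    rewrite /kirchhoff raddf_sum; apply: eq_bigr => T _.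
    rewrite -[LHS]/(map_mpoly (intr : int -> 'F_2) _) rmorph_prod.
    by apply: eq_bigr => i _; exact: map_mpolyX.
  rewrite raddf_sum -sum1dep_card natr_sum.
  (* A tree that misses an edge of the zero set contributes a vanishing factor; the monomials of the
     other trees are 1. *)
  rewrite (bigID (fun T : {set {set G}} => zeros a \subset T)) /=.
  rewrite [X in (_ + X)%R]big1 ?addr0; last first.
    move=> T /andP[_ /subsetPn[_ /imsetP[i ai0 ->] iT]]; move: ai0; rewrite inE => /eqP ai0.
    by rewrite rmorph_prod /= (bigD1 i) //= mevalXU ai0 mul0r.
  apply: eq_big => [T|T /andP[_ /subsetP sT]].
    by case: (boolP (spanning_tree T)) => [/and3P[->]|]; rewrite ?andbT ?andbF.
  rewrite rmorph_prod big1 //= => i iT; rewrite mevalXU.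
  by apply: F2_neq0; apply: contra iT => ai0; apply: sT; rewrite mem_zeros.
have eval0 (a : {ffun _ -> _}) : ((map_mpoly intr (kirchhoff G)).@[a] == 0%R) =
    ~~ odd #|[set T : {set {set G}} | [&& T \subset E, zeros a \subset T & spanning_tree T]]|.
  by rewrite evalE -(dvdn_pcharf (pchar_Fp (isT : prime 2))) dvdn2.
rewrite /point_count -(card_imset _ zeros_inj); apply: eq_card => F.
rewrite [RHS]inE; apply/imsetP/andP => [[a]|[FE even_F]].
  by rewrite inE eval0 => even_a ->.
(* The point with zero set F is the indicator function of the complement of F. *)
pose a : {ffun 'I_#|E| -> 'F_2} := [ffun i => ((enum_val i \notin F)%:R)%R].
have aF : zeros a = F.
  apply/setP => e; apply/imsetP/idP => [[i]|eF].
    by rewrite !inE ffunE => + ->; case: (_ \in F).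
  have eE := subsetP FE _ eF; exists (enum_rank_in eE e); last by rewrite enum_rankK_in.
  by rewrite !inE ffunE enum_rankK_in // eF.
by exists a; rewrite ?inE ?eval0 aF.
Qed.
End PointCount.

(** * Graphs with a vertex of degree three close to twins *)

(** Isolates the local structure of the ladder on which the argument rests: the abstract count is
    applied to the three edges at r, with [swap_edge u v] as the involution. *)
Theorem dvdn8_point_count_star_twins (G : sgraph) (r x y z u v : G) :
    uniq [:: r; x; y; z; u; v] ->
    (forall w, adj r w = (w \in [:: x; y; z])) ->
    (forall w, adj x w -> w \in [:: r; u; v]) ->
    (forall w, adj y w -> w \in [:: r; u; v]) ->
    (forall w, adj u w = adj v w) ->
  8 %| point_count 2 (kirchhoff G).
Proof.
move=> uniqG adj_r adj_x adj_y twin; rewrite point_count2_kirchhoff.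
move: (uniqG); rewrite /= !inE !negb_or -!andbA andbT.
case/and5P=> rx ry rz ru /and5P[rv xy xz xu /and5P[xv yz yu yv /and3P[zu zv uv]]].
have swap_id w : w != u -> w != v -> swap u v w = w.
  by move=> wu wv; rewrite /swap tpermD // eq_sym.
have swap_star w : w != u -> w != v -> swap_edge u v [set r; w] = [set r; w].
  by move=> wu wv; rewrite swap_edge_set2 !swap_id.
have star_edge e : e \in edges G -> r \in e ->
    [|| e == [set r; x], e == [set r; y] | e == [set r; z]].
  case/imsetP => -[a b]; rewrite inE /= => ab -> /set2P[ra|rb].
    by move: ab; rewrite -ra adj_r !inE => /or3P[]/eqP->; rewrite eqxx ?orbT.
  by move: ab; rewrite -rb adj_sym adj_r !inE setUC => /or3P[]/eqP->; rewrite eqxx ?orbT.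
have E0_free (T : {set {set G}}) :
    T \subset edges G :\ [set r; x] :\ [set r; y] :\ [set r; z] ->
    forall e, e \in T -> r \notin e.
  move/subsetP => sT e /sT; rewrite !inE => /and4P[ez ey ex eE].
  by apply: contraL (eE) => /star_edge => /(_ eE); rewrite (negPf ex) (negPf ey) (negPf ez).
have E0_sub (T : {set {set G}}) :
    T \subset edges G :\ [set r; x] :\ [set r; y] :\ [set r; z] -> T \subset edges G.
  by move/subset_trans; apply; apply: subset_trans (subsetDl _ _) _;
    apply: subset_trans (subsetDl _ _) _; exact: subsetDl.
have rxE : [set r; x] \in edges G by rewrite mem_edges adj_r !inE eqxx.
have ryE : [set r; y] \in edges G by rewrite mem_edges adj_r !inE eqxx orbT.
have rzE : [set r; z] \in edges G by rewrite mem_edges adj_r !inE eqxx !orbT.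
have treeU1 e (T : {set {set G}}) : e \in edges G -> T \subset edges G ->
    spanning_tree (e |: T) = tree (e |: T).
  by move=> eE TE; rewrite /spanning_tree subUset sub1set eE TE.
apply: (@dvdn8_count_even_trees _ _ [set r; x] [set r; y] [set r; z] _ (swap_edge u v)) => //.
- rewrite /= !inE !negb_or andbT -andbA; apply/and3P; split;
    by apply/set2_eqP => -[[_ eq1]|[eq1 _]];
    [move: xy xz yz|move: rx ry rz]; rewrite eq1 eqxx.
- move=> T /and3P[sT spT _].
  have [//|/norP[nx /norP[ny nz]]] := boolP [|| _, _ | _].
  (* If T had no star edge, {r} would be closed under T and x could not be reached from r. *)
  have := @spans_closed _ T (pred1 r) spT _ r x (eqxx r).
  rewrite /= eq_sym (negPf rx); apply => a b ab /eqP ar; move: ab; rewrite ar => rb.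
  have := star_edge _ (subsetP sT _ rb) (set21 _ _).
  by case/or3P => /eqP re; move: nx ny nz; rewrite -?re rb.
- move=> T sT; have free := E0_free T sT; have TE := E0_sub T sT.
  by rewrite !treeU1 // !(tree_leafE free).
- move=> T sT; have free := E0_free T sT; have TE := E0_sub T sT.
  rewrite !treeU1 ?subUset ?sub1set ?rxE ?ryE ?rzE //; apply: (tree_fork_even free).
  by rewrite /= !inE !negb_or rx ry rz xy xz yz.
- exact: swap_edgeK.
- exact: mem_swap_edges.
- exact: swap_star.
- exact: swap_star.
- exact: swap_star.
- exact: spanning_tree_swap.
move=> T treeT sT; apply: (fixed_star treeT uniqG) => // [w|w wu wv].
  by rewrite adj_r.
(* Invariance of T as a set, read at the edge uw, becomes the exchange of uw and vw. *)
have := edge_rel_swap u v T u w.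
by rewrite sT /edge_rel /= /swap tpermL tpermD // eq_sym.
Qed.

(** * The decompleted capped X-ladder *)

Theorem proposition4p1 (m : nat) (m_ge4 : 4 <= m) :
  c2 2 (decompleted_capped_X_ladder (leq_trans (isT : 0 < 4) m_ge4)) = 0.
Proof.
set m_gt0 := leq_trans _ _.
set G := decompleted_capped_X_ladder m_gt0.
have vertP i (lt_im : i < m) b : (i, b) != (0, false) ->
  ((Ordinal lt_im, b) : capped_X_ladder m) != u1 m_gt0 by [].
pose vert i (lt_im : i < m) b ib : G := exist _ (Ordinal lt_im, b) (@vertP i lt_im b ib).
have lt1 : 1 < m by exact: (leq_trans _ m_ge4).
have lt2 : 2 < m by exact: (leq_trans _ m_ge4).
have ltm : m.-1 < m by rewrite prednK.
have m1_ge3 : 2 < m.-1 by rewrite -ltnS prednK.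
pose r := @vert 0 m_gt0 true isT.
pose x := @vert 1 lt1 false isT.
pose y := @vert 1 lt1 true isT.
have ib : (m.-1, true) != (0, false) by rewrite xpair_eqE andbF.
pose z := @vert m.-1 ltm true ib.
pose u := @vert 2 lt2 false isT.
pose v := @vert 2 lt2 true isT.
(* As 8 = 2 * 2^2, the quotient by 2^2 is even. *)
suff dvd8 : 8 %| point_count 2 (kirchhoff G).
  by rewrite /c2 -(divnK dvd8) -[8]/(2 * 2 ^ 2) mulnA mulnK // modnMl.
have vert_eq (a b : G) : (a == b) = ((val a).1 == (val b).1 :> nat) && ((val a).2 == (val b).2).
  by rewrite -val_eqE; case: (val a) (val b) => ? ? [? ?]; rewrite xpair_eqE.
pose k := m.-1.
have adjE (a b : G) (i := val (val a).1) (j := val (val b).1) (c := (val a).2) (d := (val b).2) :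
  adj a b = ~~ ((i == j) && (c == d)) &&
   ([|| j == i.+1, [&& i == 0, j == 0 & c != d],
        [&& i == k, j == k & c != d] | [&& i == 0, j == k & c == d]] ||
    [|| i == j.+1, [&& j == 0, i == 0 & d != c],
        [&& j == k, i == k & d != c] | [&& j == 0, i == k & d == c]]).
  by rewrite -vert_eq.
(* The last layer thus lies beyond the layer of u and v: z differs from both, and the cap edge does
   not join the twins. *)
have k_ge3 : 2 < k by [].
(* The absence of u_1 leaves r with three neighbours, and x and y with r, u and v only. *)
have not_u1 (w : G) : ~~ ((val (val w).1 == 0) && ((val w).2 == false)).
  have := valP w; rewrite -[u1 _]/(Ordinal m_gt0, false).
  by case: (val w) => ? ?; rewrite xpair_eqE.
have le_k (w : G) : val (val w).1 <= k by rewrite -ltnS /k prednK ?ltn_ord.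
apply: (@dvdn8_point_count_star_twins G r x y z u v).
- rewrite /= !inE !vert_eq /= -/k.
  by case: (k) k_ge3 => [|[|[|?]]].
- move=> w; rewrite adjE !inE !vert_eq /= -/k.
  move: (not_u1 w) (le_k w) k_ge3; case: w => -[[i lt_i] b] w_neq /= {lt_i w_neq}.
  (* Layers 0, 1, 2 and the deeper ones are separated, after which adjacency is decided by
     computation. *)
  by case: (k) i b => [|[|[|n]]] // [|[|[|i]]] [] //=; rewrite ?eqSS ?andbT ?andbF ?orbF ?orbT.
- move=> w; rewrite adjE !inE !vert_eq /= -/k.
  move: (not_u1 w) (le_k w) k_ge3; case: w => -[[i lt_i] b] w_neq /= {lt_i w_neq}.
  by case: (k) i b => [|[|[|n]]] // [|[|[|i]]] [] //=; rewrite ?eqSS ?andbT ?andbF ?orbF ?orbT.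
- move=> w; rewrite adjE !inE !vert_eq /= -/k.
  move: (not_u1 w) (le_k w) k_ge3; case: w => -[[i lt_i] b] w_neq /= {lt_i w_neq}.
  by case: (k) i b => [|[|[|n]]] // [|[|[|i]]] [] //=; rewrite ?eqSS ?andbT ?andbF ?orbF ?orbT.
- move=> w; rewrite !adjE /= -/k.
  move: (not_u1 w) (le_k w) k_ge3; case: w => -[[i lt_i] b] w_neq /= {lt_i w_neq}.
  by case: (k) i b => [|[|[|n]]] // [|[|[|i]]] [] //=; rewrite ?eqSS ?andbT ?andbF ?orbF ?orbT.
Qed.
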